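(* Let $n\ge 0$ be an integer and let $p$ be a polynomial in a single complex variable of degree $\le n$ that has no zeros in the open unit disc $\mathbb{D}$. Set $$F(z)=\log\Bigl(1+\log\frac{2^n p(0)}{p(z)}\Bigr),\qquad z\in\mathbb{D}.$$ Then $$\int_{\mathbb{D}}|F'(z)|^2\,\frac{dA(z)}{\pi}\le 16n^2 .$$
   Context: $dA$ is Lebesgue area measure on $\mathbb{C}$. For such $p$ one has $|p(z)|\le 2^n|p(0)|$ on $\mathbb{D}$. The inner logarithm $\log\frac{2^np(0)}{p(z)}$ is any analytic branch on $\mathbb{D}$ (so it has nonnegative real part), and the outer logarithm is the principal branch. *)

(* Defs.v *)
From HB Require Import structures.
From mathcomp Require Import all_boot all_order all_algebra.
From mathcomp Require Import complex.
From mathcomp Require Import all_classical all_reals all_analysis.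

Set Implicit Arguments.
Unset Strict Implicit.
Unset Printing Implicit Defensive.

Import Order.TTheory GRing.Theory Num.Theory.
Import numFieldNormedType.Exports.

Local Open Scope classical_set_scope.
Local Open Scope ring_scope.
Local Open Scope complex_scope.

Notation cabs := Normc.normc.

Definition expC (R : realType) (z : R[i]) : R[i] :=
  (expR (complex.Re z) * cos (complex.Im z)) +i* (expR (complex.Re z) * sin (complex.Im z)).

(* Principal argument, with values in ]-pi, pi]; Arg 0 is irrelevant. *)
Definition Arg (R : realType) (z : R[i]) : R :=
  if 0 <= complex.Im z then acos (complex.Re z / cabs z) else - acos (complex.Re z / cabs z).

Definition Log (R : realType) (z : R[i]) : R[i] := ln (cabs z) +i* Arg z.

Definition unit_disc (R : realType) : set R[i] := [set z | cabs z < 1].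

(* The scalar field is R[i], so derivability in direction 1 is complex
   differentiability. *)
Definition analytic_on (R : realType) (D : set R[i]) (f : R[i] -> R[i]) : Prop :=
  forall z, D z -> derivable (f : R[i]^o -> R[i]^o) z 1.

Definition Cderiv (R : realType) (f : R[i] -> R[i]) : R[i] -> R[i] :=
  derive1 (f : R[i] -> R[i]^o).

Definition log_branch (R : realType) (D : set R[i]) (g L : R[i] -> R[i]) : Prop :=
  analytic_on D L /\ forall z, D z -> expC (L z) = g z.

(* Integral over a subset of the plane against area measure, the complex number
   x + iy being identified with the pair (x, y). *)
Definition area_integral (R : realType) (D : set R[i]) (f : R[i] -> \bar R)
    : \bar R :=
  (\int[(@lebesgue_measure R \x @lebesgue_measure R)%E]_(u in
     [set v : R * R | D (v.1 +i* v.2)]) f (u.1 +i* u.2))%E.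

(* Main.v *)
Require Import Defs.
From HB Require Import structures.
From mathcomp Require Import all_boot all_order all_algebra.
From mathcomp Require Import complex.
From mathcomp Require Import all_classical all_reals all_analysis.
From mathcomp Require Import measurable_realfun.
From mathcomp Require Import ring lra.

(** Factor [p = c * \prod_j ('X - a_j)] with [1 <= |a_j|] and at most [n] roots.
    Then [F' = L' / (1 + L)] with [L' = - \sum_j 1 / (z - a_j)], and since every
    factor [2 |a_j| / |z - a_j|] of [|2^n p(0) / p(z)|] is at least [1] on the
    disc, [Re L >= t_j := ln (2 |a_j| / |z - a_j|) >= 0] for each [j]. By
    Cauchy-Schwarz, [|F'|^2 <= m \sum_j (|z - a_j| (1 + t_j))^-2] with [m] the
    number of roots. On the shell where [k <= 2 t_j < k + 1], the [j]-th term is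
    at most [expR (k + 1) / (4 |a_j|^2 (1 + k / 2)^2)], and this shell is in the
    square of centre [a_j] and half-side [2 |a_j| expR (- k / 2)]; so its
    integral is at most [\sum_k 16 e / (k + 2)^2 <= 16 * 3 * (2 / 3) = 32]. The
    total is at most [32 m^2 / pi <= 16 n^2]. *)

Set Implicit Arguments.
Unset Strict Implicit.
Unset Printing Implicit Defensive.

Import Order.TTheory GRing.Theory Num.Theory.
Import numFieldNormedType.Exports.
Local Open Scope classical_set_scope.
Local Open Scope ring_scope.
Local Open Scope complex_scope.

(** * Differentiation by slopes over a numeric field *)

Section slope.
Variable K : numFieldType.
Implicit Types (f g : K -> K) (x d : K).

(* Caratheodory's form of [f] having derivative [d] at [x]: it turns the chain
   rule and the inverse function rule into algebra on slopes. *)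
Definition slope_at f x d :=
  exists s : K -> K, [/\ \forall z \near x, f z - f x = s z * (z - x),
    {for x, continuous s} & s x = d].

Lemma slope_at_derive1 f x d : slope_at f x d -> derive1 (f : K -> K^o) x = d.
Proof.
move=> [s [fs cs <-]]; apply: cvg_lim => //.
have F1 : (s \o shift x) y @[y --> 0^'] --> s x.
  exact/continuous_withinNshiftx.
apply: cvg_trans F1; apply: near_eq_cvg.
have : \forall y \near 0^', f (y + x) - f x = s (y + x) * (y + x - x).
  apply: cvg_within; move: fs; rewrite (near_shift 0 x) subr0; exact.
move=> H; near=> y.
rewrite /= (near H) // addrK [RHS]mulrC mulfK //.
by near: y; exact: nbhs_dnbhs_neq.
Unshelve. all: by end_near. Qed.

Lemma derivable_slope_at f x : derivable (f : K^o -> K^o) x 1 ->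
  slope_at f x (derive1 (f : K -> K^o) x).
Proof.
(* At [z = x] the difference quotient would be [0] by the convention for division by zero, so the
   derivative is put in there. *)
move=> df; exists (fun z => if z == x then derive1 (f : K -> K^o) x
                     else (f z - f x) / (z - x)); split.
- near=> z; case: eqP => [->|/eqP]; first by rewrite !subrr mulr0.
  by rewrite -subr_eq0 => /divfK->.
- apply/continuous_withinNshiftx; rewrite eqxx /=.
  move: df; rewrite /derivable => df.
  have F1 : (h^-1 *: ((f : K -> K^o) (h + x) - f x)) @[h --> 0^'] -->
      derive1 (f : K -> K^o) x.
    rewrite derive1E; apply: cvg_trans df; apply: near_eq_cvg.
    by near=> h; rewrite /= [h%:A]mulr1.
  apply: cvg_trans F1; apply: near_eq_cvg; near=> h => /=.
  rewrite ifN ?addrK; first by rewrite mulrC.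
  rewrite -subr_eq0 addrK; near: h; exact: nbhs_dnbhs_neq.
- by rewrite eqxx.
Unshelve. all: by end_near. Qed.

Lemma slope_at_continuous f x d : slope_at f x d -> {for x, continuous f}.
Proof.
move=> [s [fs cs _]].
have : (fun z => f x + s z * (z - x)) @ x --> f x + s x * (x - x).
  apply: (@cvgD _ _ _ (nbhs x)); first exact: cvg_cst.
  apply: (@cvgM _ _ (nbhs x)) => //.
  by apply: (@cvgB _ _ _ (nbhs x)); [exact: cvg_id|exact: cvg_cst].
rewrite subrr mulr0 addr0; apply: cvg_trans; apply: (@near_eq_cvg _ _ (nbhs x)).
by near=> z; rewrite -(near fs z)// addrC subrK.
Unshelve. all: by end_near. Qed.

Lemma slope_at_unique f x d d' : slope_at f x d -> slope_at f x d' -> d = d'.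
Proof. by move=> /slope_at_derive1 <- /slope_at_derive1. Qed.

Lemma slope_at_near f g x d : (\forall z \near x, f z = g z) ->
  slope_at f x d -> slope_at g x d.
Proof.
move=> fg [s [fs cs sx]]; exists s; split => //.
near=> z; rewrite -(near fg z)// -(nbhs_singleton fg)//; exact: (near fs).
Unshelve. all: by end_near. Qed.

Lemma slope_at_cst c x : slope_at (fun=> c) x 0.
Proof.
exists (fun=> 0); split => //; last exact: (@cvg_cst _ _ _ (nbhs x)).

by near=> z; rewrite subrr mul0r.
Unshelve. all: by end_near. Qed.

Lemma slope_at_id x : slope_at id x 1.
Proof.
exists (fun=> 1); split => //; last exact: (@cvg_cst _ _ _ (nbhs x)).

by near=> z; rewrite mul1r.
Unshelve. all: by end_near. Qed.

Lemma slope_atD f g x d d' : slope_at f x d -> slope_at g x d' ->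
  slope_at (fun z => f z + g z) x (d + d').
Proof.
move=> [s [fs cs <-]] [t [gt ct <-]]; exists (fun z => s z + t z); split => //.
  by near=> z; rewrite mulrDl -(near fs z)// -(near gt z)//; ring.
exact: (@cvgD _ _ _ (nbhs x)).
Unshelve. all: by end_near. Qed.

Lemma slope_atM f g x d d' : slope_at f x d -> slope_at g x d' ->
  slope_at (fun z => f z * g z) x (f x * d' + g x * d).
Proof.
move=> df; have cf := slope_at_continuous df.
move: df => [s [fs cs <-]] [t [gt ct <-]].
exists (fun z => f z * t z + g x * s z); split => //.
  near=> z; rewrite mulrDl -!mulrA -(near fs z)// -(near gt z)//; ring.
apply: (@cvgD _ _ _ (nbhs x)); apply: (@cvgM _ _ (nbhs x)) => //.
exact: cvg_cst.
Unshelve. all: by end_near. Qed.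

Lemma slope_at_comp f g x d d' : slope_at f x d -> slope_at g (f x) d' ->
  slope_at (fun z => g (f z)) x (d' * d).
Proof.
move=> df; have cf := slope_at_continuous df.
move: df => [s [fs cs <-]] [t [gt ct <-]].
exists (fun z => t (f z) * s z); split => //.
  have gtf : \forall z \near x, g (f z) - g (f x) = t (f z) * (f z - f x).
    exact: (cf _ gt).
  by near=> z; rewrite -mulrA -(near fs z)//; exact: (near gtf z).
by apply: (@cvgM _ _ (nbhs x)) => //; apply: continuous_comp.
Unshelve. all: by end_near. Qed.

(** The slope of [g] is the reciprocal of the slope of [f] at [g z]; continuity of [g] carries the
    slope identity and the nonvanishing of the slope back to a neighbourhood of [y]. *)
Lemma slope_at_inverse f g y d : {for y, continuous g} ->
  (\forall z \near y, f (g z) = z) -> slope_at f (g y) d -> d != 0 ->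
  slope_at g y d^-1.
Proof.
move=> cg fgK [s [fs cs sd]] d0.
exists (fun z => (s (g z))^-1); split; last by rewrite sd.
  have fsg : \forall z \near y, f (g z) - f (g y) = s (g z) * (g z - g y).
    exact: (cg _ fs).
  have sg0 : \forall z \near y, s (g z) != 0.
    have /cvgr_neq0 : {for y, continuous (s \o g)} by apply: continuous_comp.
    by apply; rewrite /= sd.
  near=> z; apply: (@mulfI _ (s (g z))); first exact: (near sg0).
  rewrite mulVKf//; last exact: (near sg0).
  have /= <- : f (g z) - f (g y) = s (g z) * (g z - g y) by exact: (near fsg).
  by rewrite (near fgK z)// (nbhs_singleton fgK).
apply: (@cvgV _ _ (nbhs y) _ (s \o g) (s (g y))); first by rewrite sd.
exact: continuous_comp.
Unshelve. all: by end_near. Qed.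

Lemma slope_at_horner (p : {poly K}) x : slope_at (horner p) x p^`().[x].
Proof.
elim/poly_ind: p => [|p c ih].
  rewrite deriv0 horner0; apply: slope_at_near (slope_at_cst 0 x).
  by near=> z; rewrite horner0.
have -> : (p * 'X + c%:P)^`().[x] = p.[x] * 1 + x * p^`().[x] + 0.
  by rewrite derivMXaddC !hornerE; ring.
have := slope_atD (slope_atM ih (slope_at_id x)) (slope_at_cst c x).
by apply: slope_at_near; near=> z; rewrite !hornerE.
Unshelve. all: by end_near. Qed.

End slope.

(** * Modulus and topology of the complex numbers *)

Section cabs.
Variable R : realType.
Implicit Types (x y : R) (z w : R[i]).
(* The topology of a numFieldType is keyed on [Num.NumField.sort], so plain
   [R[i]] carries none. *)
Local Notation C := (Num.NumField.sort (complex R : numFieldType)).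

Lemma cabsE z : `|z| = (cabs z)%:C.
Proof. by []. Qed.

Lemma cabs_ge0 z : 0 <= cabs z.
Proof. by case: z => a b; exact: sqrtr_ge0. Qed.

Lemma cabs_eq0 z : (cabs z == 0) = (z == 0).
Proof.
by apply/eqP/eqP => [/Normc.eq0_normc//|->]; rewrite Normc.normc0.
Qed.

Lemma cabs_gt0 z : (0 < cabs z) = (z != 0).
Proof. by rewrite lt_def cabs_ge0 andbT cabs_eq0. Qed.

Lemma sqr_cabs z : cabs z ^+ 2 = complex.Re z ^+ 2 + complex.Im z ^+ 2.
Proof. by case: z => a b; rewrite /= sqr_sqrtr// addr_ge0 ?sqr_ge0. Qed.

Lemma ler_Re_cabs z : `|complex.Re z| <= cabs z.
Proof.
rewrite -(@ler_pXn2r _ 2) ?nnegrE ?cabs_ge0 // sqr_cabs real_normK ?num_real//.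
by rewrite lerDl sqr_ge0.
Qed.

Lemma ler_Im_cabs z : `|complex.Im z| <= cabs z.
Proof.
rewrite -(@ler_pXn2r _ 2) ?nnegrE ?cabs_ge0 // sqr_cabs real_normK ?num_real//.
by rewrite lerDr sqr_ge0.
Qed.

Lemma ler_cabs_Re_Im z : cabs z <= `|complex.Re z| + `|complex.Im z|.
Proof.
rewrite -(@ler_pXn2r _ 2) ?nnegrE ?cabs_ge0 ?addr_ge0 // sqr_cabs.
rewrite sqrrD !real_normK ?num_real//.
by rewrite -addrA lerD2l lerDr mulrn_wge0// mulr_ge0.
Qed.

Lemma cabsN z : cabs (- z) = cabs z.
Proof. by apply/complexI; rewrite -!cabsE normrN. Qed.

Lemma ler_cabsD z w : cabs (z + w) <= cabs z + cabs w.
Proof. by rewrite -lecR rmorphD -!cabsE ler_normD. Qed.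

(** The norm of [R[i]] takes values in [R[i]], so radii are complex; a positive complex number is
    real, which allows a return to the real modulus. *)
Lemma cabs_cvgP (T : Type) (F : set_system T) (FF : Filter F) (f : T -> C)
    (l : C) :
  (forall e, 0 < e -> \forall t \near F, cabs (l - f t) < e) -> f @ F --> l.
Proof.
move=> H; apply/cvgrPdist_lt => e e0.
have [eI eR] : complex.Im e = 0 /\ 0 < complex.Re e.
  by move: e0; rewrite ltcE /= => /andP[/eqP -> ->].
near=> t.
have -> : e = (complex.Re e)%:C by rewrite [LHS]complexE eI mulr0 addr0.
rewrite cabsE ltcR; near: t; exact: H.
Unshelve. all: by end_near. Qed.

Lemma near_cabsP (l : C) (P : set C) e : 0 < e ->
  (forall t, cabs (l - t) < e -> P t) -> \forall t \near l, P t.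
Proof.
move=> e0 H; exists e%:C; first by rewrite /= ltcR.
by move=> t /=; rewrite cabsE ltcR; exact: H.
Qed.

Lemma continuous_Re : continuous (@complex.Re R : C -> R).
Proof.
move=> z; apply/(@cvgrPdist_lt _ _ _ (nbhs z)) => e e0.
apply: (near_cabsP e0) => t; apply: le_lt_trans.
by rewrite (_ : _ - _ = complex.Re (z - t)) ?ler_Re_cabs//; case: z; case: t.
Qed.

Lemma continuous_Im : continuous (@complex.Im R : C -> R).
Proof.
move=> z; apply/(@cvgrPdist_lt _ _ _ (nbhs z)) => e e0.
apply: (near_cabsP e0) => t; apply: le_lt_trans.
by rewrite (_ : _ - _ = complex.Im (z - t)) ?ler_Im_cabs//; case: z; case: t.
Qed.

Lemma continuous_cabs : continuous (@Normc.normc R : C -> R).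
Proof.
move=> z; apply/(@cvgrPdist_lt _ _ _ (nbhs z)) => e e0.
apply: (near_cabsP e0) => t; apply: le_lt_trans.
have h1 : cabs z <= cabs (z - t) + cabs t by rewrite -{1}(subrK t z) ler_cabsD.
have h2 : cabs t <= cabs (z - t) + cabs z.
  by rewrite -(cabsN (z - t)) opprB -{1}(subrK z t) ler_cabsD.
by rewrite ler_norml; lra.
Qed.

Lemma cvg_complex (T : Type) (F : set_system T) (FF : Filter F) (f g : T -> R)
    a b :
  f @ F --> a -> g @ F --> b ->
  ((f t +i* g t) : C) @[t --> F] --> (a +i* b : C).
Proof.
move=> fa gb; apply: cabs_cvgP => e e0.
have e2 : 0 < e / 2 by rewrite divr_gt0.
have ha : \forall t \near F, `|a - f t| < e / 2.
  by move/cvgrPdist_lt : fa; exact.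
have hb : \forall t \near F, `|b - g t| < e / 2.
  by move/cvgrPdist_lt : gb; exact.
near=> t; apply: le_lt_trans (ler_cabs_Re_Im _) _ => /=.
by rewrite [e]splitr; apply: ltrD; [exact: (near ha)|exact: (near hb)].
Unshelve. all: by end_near. Qed.

End cabs.

(** * The complex exponential and its derivative *)

Section expC.
Variable R : realType.
Local Notation C := (Num.NumField.sort (complex R : numFieldType)).
Implicit Types (x y : R) (z w : R[i]).

Lemma expCD z w : expC (z + w) = expC z * expC w.
Proof.
case: z => a b; case: w => c d; rewrite /expC /= expRD cosD sinD.
by apply/eqP; rewrite eq_complex /=; apply/andP; split; apply/eqP; ring.
Qed.

Lemma cabs_expC z : cabs (expC z) = expR (complex.Re z).
Proof.
case: z => a b; rewrite /expC /= !exprMn -mulrDr cos2Dsin2 mulr1 sqrtr_sqr.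
by rewrite ger0_norm ?expR_ge0.
Qed.

Lemma expC_neq0 z : expC z != 0.
Proof. by rewrite -cabs_gt0 cabs_expC expR_gt0. Qed.

Lemma expR_taylor1_bound x : `|x| <= 1 / 2 -> `|expR x - 1 - x| <= 2 * x ^+ 2.
Proof.
rewrite ler_norml => /andP[x1 x2].
have h1 := expR_ge1Dx x; have h2 := expR_ge1Dx (- x).
rewrite ger0_norm; last by lra.
(* The inequality [1 + y <= expR y] at [y = - x] gives the upper bound on [expR x]. *)
have : expR x * (1 - x) <= 1.
  apply: le_trans (_ : expR x * expR (- x) <= 1); last by rewrite expRxMexpNx_1.
  by rewrite ler_pM2l ?expR_gt0.
nra.
Qed.

(** The exact form [cos c * x] serves both the bound of [sin x] by [x] and the second-order bound on
    [sin x - x]. *)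
Lemma sin_mean_value x : exists2 c : R, `|c| <= `|x| & sin x = cos c * x.
Proof.
wlog x0 : x / 0 <= x => [H|].
  have [/H//|/ltW x0] := leP 0 x.
  have [|c] := H (- x); first by rewrite oppr_ge0.
  by rewrite normrN => cx; rewrite sinN mulrN => /oppr_inj ->; exists c.
have [|c] := MVT_segment x0 (fun y _ => is_derive_sin y).
  by apply: continuous_subspaceT => y; exact: continuous_sin.
rewrite in_itv /= => /andP[c0 cx]; rewrite sin0 !subr0 => ->; exists c => //.
by rewrite !ger0_norm.
Qed.

Lemma norm_sin_le x : `|sin x| <= `|x|.
Proof.
have [c _ ->] := sin_mean_value x.
by rewrite normrM ler_piMl// ler_norml cos_geN1 cos_le1.
Qed.

Lemma cos_taylor1_bound x : `|1 - cos x| <= x ^+ 2.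
Proof.
have -> : 1 - cos x = 2 * sin (x / 2) ^+ 2.
  rewrite {1}[x]splitr cosD -!expr2 cos2sin2; ring.
rewrite ger0_norm; last by apply: mulr_ge0; rewrite ?sqr_ge0.
have h := norm_sin_le (x / 2).
have : `|sin (x / 2)| ^+ 2 <= `|x / 2| ^+ 2 by rewrite ler_pXn2r ?nnegrE.
rewrite !real_normK ?num_real// exprMn => {}h.
have := sqr_ge0 x; lra.
Qed.

Lemma sin_taylor1_bound x : `|x| <= 1 -> `|sin x - x| <= x ^+ 2.
Proof.
move=> x1; have [c cx ->] := sin_mean_value x.
rewrite -{2}(mul1r x) -mulrBl normrM -real_normK ?num_real// expr2 ler_wpM2r//.
rewrite distrC (le_trans (cos_taylor1_bound c))// -real_normK ?num_real// expr2.
by rewrite (le_trans (ler_pM _ _ cx cx))// ler_piMl.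
Qed.

(** The real and imaginary parts are expanded in the remainders of [expR], [cos] and [sin]; each
    contributes at most [4 * cabs z ^+ 2]. *)
Lemma expC_taylor1_bound z : cabs z <= 1 / 2 ->
  cabs (expC z - 1 - z) <= 8 * cabs z ^+ 2.
Proof.
move=> z2; apply: le_trans (ler_cabs_Re_Im _) _; set r := cabs z.
have hx := le_trans (ler_Re_cabs z) z2.
have hy := le_trans (ler_Im_cabs z) z2.
have := ler_Re_cabs z; have := ler_Im_cabs z.
move: z2 hx hy; rewrite -/r; move: r => r.
case: z => x y /= r2 hx hy yr xr.
have r0 : 0 <= r by exact: le_trans xr.
have xr2 : x ^+ 2 <= r ^+ 2.
  by rewrite -(real_normK (num_real x)) ler_pXn2r ?nnegrE.
have yr2 : y ^+ 2 <= r ^+ 2.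
  by rewrite -(real_normK (num_real y)) ler_pXn2r ?nnegrE.
have r20 := sqr_ge0 r.
have he := expR_taylor1_bound hx; have hc := cos_taylor1_bound y.
have hs : `|sin y - y| <= y ^+ 2 by apply: sin_taylor1_bound; lra.
have hsin := norm_sin_le y.
have cos1 : `|cos y| <= 1 by rewrite ler_norml cos_geN1 cos_le1.
have hre : `|expR x * cos y - 1 - x| <= 4 * r ^+ 2.
  have -> : expR x * cos y - 1 - x =
      (expR x - 1 - x) * cos y - (1 + x) * (1 - cos y).
    by ring.
  apply: le_trans (ler_normB _ _) _; rewrite !normrM.
  have h1 : `|expR x - 1 - x| * `|cos y| <= `|expR x - 1 - x|.
    exact: ler_piMr.
  have h2 : `|1 + x| * `|1 - cos y| <= (3 / 2) * y ^+ 2.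
    apply: ler_pM => //; apply: le_trans (ler_normD _ _) _; rewrite normr1; lra.
  lra.
have him : `|expR x * sin y - y| <= 4 * r ^+ 2.
  have -> : expR x * sin y - y =
      (expR x - 1 - x) * sin y + x * sin y + (sin y - y).
    by ring.
  apply: le_trans (ler_normD _ _) _.
  apply: le_trans (lerD (ler_normD _ _) (lexx _)) _; rewrite !normrM.
  have h1 : `|expR x - 1 - x| * `|sin y| <= `|expR x - 1 - x|.
    by apply: ler_piMr => //; lra.
  have h2 : `|x| * `|sin y| <= r * r.
    by apply: ler_pM => //; exact: le_trans yr.
  by rewrite -expr2 in h2; lra.
rewrite subr0; lra.
Qed.

(** By the addition law, the slope differs from [expC z] by [expC z] times the Taylor remainder at
    [w - z] divided by [w - z], which is of order [w - z]. *)
Lemma slope_at_expC z : @slope_at _ (@expC R) z (expC z).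
Proof.
pose s (w : R[i]) := if w == z then expC z else (expC w - expC z) / (w - z).
exists s; split; last by rewrite /s eqxx.
  near=> w; rewrite /s; case: eqP => [->|/eqP]; first by rewrite !subrr mulr0.
  by rewrite -subr_eq0 => /divfK->.
rewrite /prop_for /continuous_at.
apply: (@cabs_cvgP _ _ (nbhs (z : C))) => e e0.
pose M := 8 * cabs (expC z).
have M0 : 0 < M by rewrite mulr_gt0// cabs_gt0 expC_neq0.
(* Radius [1 / 2] makes the Taylor bound available; [e / M] brings the error, at most
   [M * cabs (z - w)], below [e]. *)
have d0 : 0 < Order.min (1 / 2) (e / M) by rewrite lt_min !divr_gt0.
apply: (near_cabsP d0) => w; rewrite lt_min => /andP[w2 we].
have [->|wz] := eqVneq w z; first by rewrite /s eqxx subrr Normc.normc0.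
rewrite /s eqxx (negbTE wz).
have wz0 : w - z != 0 by rewrite subr_eq0.
have -> : expC z - (expC w - expC z) / (w - z) =
   - (expC z * (expC (w - z) - 1 - (w - z)) / (w - z)).
  rewrite -{1}(subrK z w) expCD; field.
  by [].
rewrite cabsN !Normc.normcM Normc.normcV ltr_pdivrMr ?cabs_gt0//.
have hw : cabs (w - z) = cabs (z - w) by rewrite -cabsN opprB.
apply: le_lt_trans (_ : cabs (expC z) * (8 * cabs (w - z) ^+ 2) < _).
  by rewrite ler_wpM2l ?cabs_ge0// expC_taylor1_bound// hw ltW.
rewrite expr2 !mulrA ltr_pM2r ?cabs_gt0// -(mulrC 8) -/M hw.
by rewrite mulrC -ltr_pdivlMr.
Unshelve. all: by end_near. Qed.

End expC.

(** * The principal logarithm on the right half-plane *)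

Section Log.
Variable R : realType.
Local Notation C := (Num.NumField.sort (complex R : numFieldType)).
Implicit Types (x y : R) (z w : R[i]).

Lemma cos_atan_Im_Re z : 0 < complex.Re z ->
  cos (atan (complex.Im z / complex.Re z)) = complex.Re z / cabs z.
Proof.
move=> z0; rewrite cos_atan.
have -> : 1 + (complex.Im z / complex.Re z) ^+ 2 = (cabs z / complex.Re z) ^+ 2.
  by rewrite !exprMn sqr_cabs; field; rewrite gt_eqF.
by rewrite sqrtr_sqr ger0_norm ?divr_ge0 ?cabs_ge0 ?ltW// invf_div.
Qed.

(** The arctangent form has no case split on the sign of the imaginary part, so continuity of [Log]
    can be read off it. *)
Lemma Arg_atan z :
  0 < complex.Re z -> Arg z = atan (complex.Im z / complex.Re z).
Proof.
move=> z0; have ct := cos_atan_Im_Re z0; rewrite /Arg -ct.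
move: ct z0; set x := complex.Re z; set y := complex.Im z => ct x0.
set t := atan (y / x).
have tl := atan_gtNpi2 (y / x); have tu := atan_ltpi2 (y / x).
have pi0 := pi_gt0 R.
case: ifPn => [y0|].
  have t0 : 0 <= t.
    by rewrite -(atan0 R); apply: le_atan; rewrite divr_ge0 // ltW.
  by apply: cosK; rewrite in_itv /= t0 /=; rewrite -/t in tu; lra.
rewrite -ltNge => y0.
have t0 : t <= 0.
  by rewrite -(atan0 R); apply: le_atan; rewrite pmulr_lle0 ?invr_gt0 // ltW.
by rewrite cosKN ?opprK// t0 andbT; rewrite -/t in tl; lra.
Qed.

Lemma expC_Log z : 0 < complex.Re z -> expC (Log z) = z.
Proof.
move=> z0; have zn0 : z != 0 by apply: contraTneq z0 => ->; rewrite ltxx.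
have r0 : 0 < cabs z by rewrite cabs_gt0.
rewrite /expC /Log /= lnK ?posrE// Arg_atan//.
have c0 := cos_gt0_pihalf (atan_def (complex.Im z / complex.Re z)).1.
have := atanK (complex.Im z / complex.Re z).
have := cos_atan_Im_Re z0.
move: c0; set t := atan _ => c0 ct; rewrite /tan => /eqP.
rewrite eqr_div ?(gt_eqF c0) ?(gt_eqF z0)// => /eqP st.
have {}st : sin t = complex.Im z / cabs z.
  apply: (@mulIf _ (complex.Re z)); first by rewrite gt_eqF.
  by rewrite st ct; ring.
rewrite ct st !(mulrC (cabs z)) !divfK ?gt_eqF//.
by case: z {z0 zn0 r0 t c0 ct st}.
Qed.

(** [Log] is a continuous right inverse of [expC] near [z], so the inverse function rule applies.
    The right half-plane is enough, since [1 + L] takes its values there. *)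
Lemma slope_at_Log z : 0 < complex.Re z -> slope_at (@Log R) z z^-1.
Proof.
move=> z0; rewrite -{2}(expC_Log z0).
have near_Re : \forall w \near (z : C), 0 < complex.Re w.
  by have := @continuous_Re R z; move/cvgr_gt; apply.
apply: (@slope_at_inverse _ (@expC R)).
- have H : {for (z : C), continuous (fun w : C =>
      (ln (cabs w) +i* atan (complex.Im w / complex.Re w)) : C)}.
    apply: (@cvg_complex _ _ (nbhs (z : C))).
      apply: (@continuous_comp _ _ _ (@Normc.normc R : C -> R) (@ln R)).
        exact: continuous_cabs.
      apply: continuous_ln; rewrite cabs_gt0.
      by apply: contraTneq z0 => ->; rewrite ltxx.
    apply: (@continuous_comp _ _ _
      (fun w : C => complex.Im w / complex.Re w) (@atan R)).
      apply: (@cvgM _ _ (nbhs (z : C))); first exact: continuous_Im.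
      apply: (@cvgV _ _ (nbhs (z : C)) _ _ (complex.Re z)).
        by rewrite gt_eqF.
      exact: continuous_Re.
    exact: continuous_atan.
  rewrite /prop_for /continuous_at {2}/Log Arg_atan//.
  apply: cvg_trans H; apply: (@near_eq_cvg _ _ (nbhs (z : C))).
  by near=> w; rewrite /Log Arg_atan//; exact: (near near_Re).
- near=> w; apply: expC_Log; exact: (near near_Re).
- exact: slope_at_expC.
- exact: expC_neq0.
Unshelve. all: by end_near. Qed.

End Log.

(** * Comparison of integrals and series with nonnegative terms *)

Section integral_bound.
Context (d : measure_display) (T : measurableType d) (R : realType).
Variable mu : {measure set T -> \bar R}.
Local Open Scope ereal_scope.
Import HBNNSimple.

(* Neither [D] nor [f] and [g] need be measurable: for nonnegative functions the
   integral is a supremum over simple functions. *)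
Lemma ge0_le_integral_superset (D : set T) (f g : T -> \bar R) :
  (forall x, D x -> 0 <= f x) -> (forall x, 0 <= g x) ->
  (forall x, D x -> f x <= g x) ->
  \int[mu]_(x in D) f x <= \int[mu]_x g x.
Proof.
move=> f0 g0 fg; rewrite ge0_integralE// ge0_integralTE//.
apply: ereal_sup_le => _ [h /= hf <-].
exists h => //= x; apply: le_trans (hf x) _; rewrite /patch.
by case: ifPn => // /set_mem /fg.
Qed.

Lemma nneseries_ge_term (u : (\bar R)^nat) k : (forall n, 0 <= u n) ->
  u k <= \sum_(n <oo) u n.
Proof.
move=> u0; apply: le_trans (@nneseries_lim_ge R u xpredT 0%N k.+1 _); last by [].
by rewrite big_nat_recr//= leeDr// sume_ge0.
Qed.

End integral_bound.

(** * An integrable majorant for the contribution of one root *)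

Section majorant.
Variable R : realType.
Local Notation mu2 := (@lebesgue_measure R \x @lebesgue_measure R)%E.
Implicit Types (a z : R[i]) (k : nat).

(* On the shell [k <= 2 * ln (2 |a| / |z - a|) < k + 1] the point [z] lies in
   [majorant_square a k], and [majorant_weight a k] bounds the integrand. *)
Definition majorant_radius a k : R := 2 * cabs a * expR (- (k%:R / 2)).

Definition majorant_square a k : set (R * R) :=
  `[complex.Re a - majorant_radius a k, complex.Re a + majorant_radius a k] `*`
  `[complex.Im a - majorant_radius a k, complex.Im a + majorant_radius a k].

Definition majorant_weight a k : R :=
  expR (k%:R + 1) / (4 * cabs a ^+ 2 * (1 + k%:R / 2) ^+ 2).

(** Every square containing the point contributes, not only the one of its shell: a single term is
    enough for the pointwise bound, and each term has an explicit integral. Extended real values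
    allow divergence at the centre. *)
Definition majorant a (v : R * R) : \bar R :=
  (\sum_(k <oo) (majorant_weight a k)%:E * (\1_(majorant_square a k) v)%:E)%E.

Lemma majorant_weight_ge0 a k : 0 <= majorant_weight a k.
Proof.
apply: divr_ge0; first exact: expR_ge0.
by apply: mulr_ge0; [apply: mulr_ge0|]; rewrite ?sqr_ge0.
Qed.

Lemma majorant_radius_ge0 a k : 0 <= majorant_radius a k.
Proof. by rewrite !mulr_ge0 ?cabs_ge0 ?expR_ge0. Qed.

Lemma majorant_term_ge0 a k v :
  (0 <= (majorant_weight a k)%:E * (\1_(majorant_square a k) v)%:E)%E.
Proof. by rewrite mule_ge0 ?lee_fin ?majorant_weight_ge0. Qed.

Lemma measurable_majorant_square a k : measurable (majorant_square a k).
Proof. by apply: measurableX; exact: measurable_itv. Qed.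

Lemma majorant_square_area a k :
  (mu2 (majorant_square a k) = ((2 * majorant_radius a k) ^+ 2)%:E)%E.
Proof.
have r0 := majorant_radius_ge0 a k.
have itvE (x : R) :
    lebesgue_measure `[x - majorant_radius a k, x + majorant_radius a k] =
    (2 * majorant_radius a k)%:E.
  rewrite lebesgue_measure_itv /= lte_fin.
  case: ifPn => [_|]; first by rewrite -EFinB; congr EFin; ring.
  (* If the endpoints are not strictly ordered, the radius is [0] and both sides vanish. *)
  by rewrite -leNgt => h; congr EFin; lra.
rewrite product_measure1E; [|exact: measurable_itv..].
apply: etrans (congr2 (fun x y => (x * y)%E) (itvE _) (itvE _)) _.
by rewrite -EFinM.
Qed.

Lemma expR1_le3 : expR 1 <= 3 :> R.
Proof.
(* Eighth powers suffice because [3 * (7 / 8) ^+ 8 >= 1]. *)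
have h : (7 / 8 : R) <= expR (- (1 / 8)).
  by apply: le_trans (expR_ge1Dx _); lra.
have h8 : (7 / 8 : R) ^+ 8 <= expR (- 1).
  have -> : -1 = 8%:R * - (1 / 8) :> R by field.
  by rewrite expRM_natl; rewrite ler_pXn2r ?nnegrE ?expR_ge0//; lra.
rewrite -(ler_pM2r (expR_gt0 (- 1 : R))) expRxMexpNx_1.
by apply: le_trans (_ : 3 * (7 / 8) ^+ 8 <= _); lra.
Qed.

(** The exponential growth of the weight cancels the exponential decay of the area. What makes the
    series converge is the factor [(1 + k / 2) ^+ 2], which comes from the outer logarithm. *)
Lemma majorant_weight_area a k : a != 0 ->
  majorant_weight a k * (2 * majorant_radius a k) ^+ 2 =
  16 * expR 1 / (k%:R + 2) ^+ 2.
Proof.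
move=> a0; have ca0 : cabs a != 0 by rewrite cabs_eq0.
have e0 : expR (k%:R / 2 : R) != 0 by rewrite gt_eqF ?expR_gt0.
have k2 : k%:R + 2 != 0 :> R by rewrite gt_eqF// ltr_wpDl.
rewrite /majorant_weight /majorant_radius expRD expRN {1}[k%:R]splitr expRD.
by field; rewrite ca0 e0 k2.
Qed.

Lemma measurable_majorant_term a k :
  measurable_fun setT
    (fun v => (majorant_weight a k)%:E * (\1_(majorant_square a k) v)%:E)%E.
Proof.
apply: measurable_funeM; apply/measurable_EFinP.
exact: measurable_indic (measurable_majorant_square a k).
Qed.

Lemma measurable_majorant a : measurable_fun setT (majorant a).
Proof.
apply: (@ge0_emeasurable_sum _ _ _ _ _ xpredT) => [k v _ _|k _].
  exact: majorant_term_ge0.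
exact: measurable_majorant_term.
Qed.

Lemma integral_majorant a : a != 0 -> (\int[mu2]_v majorant a v <= 32%:E)%E.
Proof.
move=> a0; rewrite /majorant integral_nneseries//; last 2 first.
- by move=> k; exact: measurable_majorant_term.
- by move=> k v _; exact: majorant_term_ge0.
have E k :
    (\int[mu2]_v ((majorant_weight a k)%:E * (\1_(majorant_square a k) v)%:E) =
    (16 * expR 1 / (k%:R + 2) ^+ 2)%:E)%E.
  rewrite ge0_integralZl_EFin ?majorant_weight_ge0//; last first.
    apply/measurable_EFinP.
    exact: measurable_indic (measurable_majorant_square a k).
  rewrite integral_indic//; last exact: measurable_majorant_square.
  rewrite setIT -(majorant_weight_area k a0) (EFinM (majorant_weight a k)).
  by rewrite -majorant_square_area.
under eq_eseriesr do rewrite E.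
apply: lime_le.
  apply: is_cvg_nneseries => k _ _.
  by rewrite lee_fin divr_ge0 ?sqr_ge0// mulr_ge0 ?expR_ge0.
apply: nearW => N; rewrite sumEFin lee_fin.
(* An explicit remainder makes the induction work: [48 = 16 * 3] comes from [expR 1 <= 3], and
   [48 / (3 / 2) = 32] makes the bound [0] at [N = 0]. *)
suff : \sum_(0 <= k < N) (16 * expR 1 / (k%:R + 2) ^+ 2) <=
    32 - 48 / (N%:R + 3 / 2) :> R.
  move/le_trans; apply; rewrite gerBl divr_ge0// addr_ge0//.
elim: N => [|N ih].
  by rewrite big_geq// (_ : 32 - _ = 0)//; field.
rewrite big_nat_recr//=; apply: le_trans (lerD ih (lexx _)) _.
(* [1 / (N + 2)^2 <= 1 / ((N + 3/2) (N + 5/2))], which telescopes *)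
have N0 : 0 <= N%:R :> R by [].
have h : 16 * expR 1 / (N%:R + 2) ^+ 2 <=
    48 / (N%:R + 3 / 2) - 48 / (N%:R + 5 / 2) :> R.
  have -> : 48 / (N%:R + 3 / 2) - 48 / (N%:R + 5 / 2) =
      48 / ((N%:R + 2) ^+ 2 - 1 / 4) :> R.
    field; rewrite ?gt_eqF//=; nra.
  apply: ler_pM; rewrite ?mulr_ge0 ?expR_ge0 ?invr_ge0 ?sqr_ge0//.
    by have := expR1_le3; lra.
  rewrite lef_pV2 ?posrE; nra.
have -> : N.+1%:R + 3 / 2 = N%:R + 5 / 2 :> R by rewrite -natr1; field.
lra.
Qed.

Lemma majorant_ge a z (t := ln (2 * cabs a / cabs (z - a))) :
  z != a -> cabs (z - a) <= 2 * cabs a ->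
  (((cabs (z - a) * (1 + t)) ^- 2)%:E <=
   majorant a (complex.Re z, complex.Im z))%E.
Proof.
move=> za hz.
have u0 : 0 < cabs (z - a) by rewrite cabs_gt0 subr_eq0.
have a0 : 0 < cabs a by have : 0 < 2 * cabs a by [exact: lt_le_trans hz]; lra.
have q0 : 0 < 2 * cabs a / cabs (z - a) by rewrite divr_gt0 ?mulr_gt0.
have t0 : 0 <= t by apply: ln_ge0; rewrite ler_pdivlMr ?mul1r.
have ut : cabs (z - a) = 2 * cabs a * expR (- t).
  by rewrite expRN lnK ?posrE// invf_div mulrC divfK// gt_eqF// mulr_gt0.
(* The index of the shell of [z]: [k <= 2 * t] puts [z] in the square, and [2 * t < k + 1] bounds
   [expR (2 * t)] by the numerator of the weight. *)
pose k := Num.truncn (2 * t).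
have /andP[k1 k2] : k%:R <= 2 * t < k.+1%:R.
  by apply: truncn_itv; rewrite mulr_ge0.
have zsq : majorant_square a k (complex.Re z, complex.Im z).
  have ur : cabs (z - a) <= majorant_radius a k.
    by rewrite ut /majorant_radius ler_pM2l ?mulr_gt0// ler_expR; lra.
  have := le_trans (ler_Re_cabs _) ur; have := le_trans (ler_Im_cabs _) ur.
  rewrite !ler_norml; case: (z) => x y; case: (a) => b c /=.
  by move=> ? ?; split; rewrite /= in_itv /=; lra.
apply: le_trans (nneseries_ge_term k (fun k => majorant_term_ge0 a k _)).
rewrite indicE mem_set// mule1 lee_fin /majorant_weight.
rewrite -(invrK (expR (k%:R + 1))) -invfM -expRN.
have e2t : expR (- t) ^+ 2 = expR (- (2 * t)) by rewrite -expRM_natl mulrN.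
rewrite lef_pV2 ?posrE; last 2 first.
- by rewrite exprn_gt0// mulr_gt0//; lra.
- by rewrite !mulr_gt0 ?expR_gt0 ?exprn_gt0// ltr_wpDr.
have -> : (cabs (z - a) * (1 + t)) ^+ 2 =
    expR (- (2 * t)) * (4 * cabs a ^+ 2 * (1 + t) ^+ 2).
  by rewrite ut -e2t; ring.
apply: ler_pM; [exact: expR_ge0| | |].
- by apply: mulr_ge0; [apply: mulr_ge0|]; rewrite ?sqr_ge0.
- by rewrite ler_expR; rewrite -natr1 in k2; lra.
- rewrite ler_pM2l ?mulr_gt0 ?exprn_gt0//.
  have k0 : 0 <= k%:R :> R by [].
  by rewrite ler_pXn2r ?nnegrE//; lra.
Qed.

End majorant.

(** * Cauchy-Schwarz and the logarithmic derivative of a product *)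

Lemma sqr_sum_le (R : realFieldType) (I : Type) (r : seq I) (x : I -> R) :
  (\sum_(i <- r) x i) ^+ 2 <= (size r)%:R * \sum_(i <- r) x i ^+ 2.
Proof.
elim: r => [|i r ih]; first by rewrite !big_nil expr0n mul0r.
rewrite !big_cons /= -natr1; move: ih.
set S := \sum_(j <- r) x j; set Q := \sum_(j <- r) x j ^+ 2.
have m0 : 0 <= (size r)%:R :> R by [].
have Q0 : 0 <= Q by rewrite sumr_ge0// => j _; rewrite sqr_ge0.
move: (size r)%:R (x i) m0 => m y m0 h.
(* The induction hypothesis [S ^+ 2 <= m * Q] is combined with [4 * u * v <= (u + v) ^+ 2] for
   [u = m * y ^+ 2] and [v = Q]. *)
have mQ : (2 * y * S) ^+ 2 <= (m * y ^+ 2 + Q) ^+ 2.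
  have := sqr_ge0 (m * y ^+ 2 - Q); have := ler_wpM2l (sqr_ge0 (2 * y)) h; nra.
have mQ0 : 0 <= m * y ^+ 2 + Q.
  by apply: addr_ge0 => //; apply: mulr_ge0 => //; exact: sqr_ge0.
have : 2 * y * S <= m * y ^+ 2 + Q.
  apply: le_trans (ler_norm _) _.
  by rewrite -(@ler_pXn2r _ 2) ?nnegrE// real_normK ?num_real.
by nra.
Qed.

(** The logarithmic derivative in multiplied form; repeated entries of [s] account for multiple
    roots. *)
Lemma deriv_prod_XsubC (K : fieldType) (s : seq K) (z : K) : z \notin s ->
  (\prod_(a <- s) ('X - a%:P))^`().[z] =
  (\prod_(a <- s) ('X - a%:P)).[z] * \sum_(a <- s) (z - a)^-1.
Proof.
elim: s => [|a s ih]; first by rewrite !big_nil derivC horner0 mulr0.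
rewrite inE negb_or => /andP[za zs]; rewrite !big_cons derivM hornerD !hornerM.
rewrite ih// derivXsubC hornerXsubC hornerC mulrDr mul1r; congr (_ + _).
  by rewrite mulrAC mulfV ?mul1r// subr_eq0.
by rewrite mulrA.
Qed.

(** * Estimates for the branch [L] and the energy bound for a factored polynomial *)

Section log_branch_energy.
Variable R : realType.
Variables (n : nat) (p : {poly R[i]}) (s : seq R[i]) (c : R[i]).
Variable L : R[i] -> R[i].
Hypothesis ps : p = c *: \prod_(a <- s) ('X - a%:P).
Hypothesis sn : (size s <= n)%N.
Hypothesis c0 : c != 0.
Hypothesis s_out : forall a, a \in s -> 1 <= cabs a.
Hypothesis L_log :
  log_branch (@unit_disc R) (fun z => 2 ^+ n * p.[0] / p.[z]) L.
Local Notation D := (@unit_disc R).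
Local Notation mu2 := (@lebesgue_measure R \x @lebesgue_measure R)%E.

Lemma root_neq z a : D z -> a \in s -> z != a.
Proof.
rewrite /unit_disc /= => z1 /s_out a1.
by apply: contraTneq z1 => ->; rewrite -leNgt.
Qed.

Lemma root_cabs_gt0 a : a \in s -> 0 < cabs a.
Proof. by move/s_out; apply: lt_le_trans. Qed.

Lemma p_neq0 z : D z -> p.[z] != 0.
Proof.
move=> Dz; rewrite ps hornerZ mulf_neq0// horner_prod.
rewrite prodf_seq_neq0; apply/allP => a sa /=.
by rewrite !hornerE subr_eq0 root_neq.
Qed.

Lemma cabs_root_le z a : D z -> a \in s -> cabs (z - a) <= 2 * cabs a.
Proof.
move=> Dz /s_out a1; apply: le_trans (ler_cabsD _ _) _; rewrite cabsN.
by move: Dz; rewrite /unit_disc /= => ?; lra.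
Qed.

Lemma cabs_horner_XsubC z :
  cabs p.[z] = cabs c * \prod_(a <- s) cabs (z - a).
Proof.
rewrite ps hornerZ Normc.normcM horner_prod; congr (_ * _).
elim: s => [|a t ih]; first by rewrite !big_nil Normc.normc1.
by rewrite !big_cons Normc.normcM ih !hornerE.
Qed.

Lemma ratio_ge1 z a : D z -> a \in s -> 1 <= 2 * cabs a / cabs (z - a).
Proof.
move=> Dz sa; rewrite ler_pdivlMr ?mul1r ?cabs_root_le// cabs_gt0 subr_eq0.
exact: root_neq.
Qed.

(** As [p.[0]] is [c] times the product of the [- a], each root absorbs one factor [2]; the power
    [n - size s] counts those left over when the degree is below [n]. *)
Lemma cabs_quotientE z : cabs (2 ^+ n * p.[0] / p.[z]) =
  2 ^+ (n - size s) * \prod_(a <- s) (2 * cabs a / cabs (z - a)).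
Proof.
have cabs2 : cabs (2 ^+ n : R[i]) = 2 ^+ n.
  by apply/complexI; rewrite -cabsE normrX normr_nat rmorphXn rmorph_nat.
have -> : \prod_(a <- s) (2 * cabs a / cabs (z - a)) =
    2 ^+ size s * (\prod_(a <- s) cabs (0 - a)) / \prod_(a <- s) cabs (z - a).
  elim: s => [|a t ih]; first by rewrite !big_nil invr1 !mulr1.
  by rewrite !big_cons ih sub0r cabsN exprS invfM /=; ring.
rewrite !Normc.normcM Normc.normcV !cabs_horner_XsubC cabs2 invfM.
rewrite -{1}(subnK sn) exprD.
have cc0 : cabs c != 0 by rewrite cabs_eq0.
by rewrite !mulrA; congr (_ * _); rewrite mulrAC mulfK// -!mulrA.
Qed.

Lemma prod_ratio_ge1 z (t : seq R[i]) : D z -> {subset t <= s} ->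
  1 <= \prod_(a <- t) (2 * cabs a / cabs (z - a)).
Proof.
move=> Dz ts; rewrite big_seq; elim/big_ind : _ => // [x y|a /ts].
  exact: mulr_ege1.
exact: ratio_ge1.
Qed.

Lemma cabs_quotient_ge1 z : D z -> 1 <= cabs (2 ^+ n * p.[0] / p.[z]).
Proof.
move=> Dz; rewrite cabs_quotientE mulr_ege1//; last exact: prod_ratio_ge1.
by rewrite exprn_ege1// ler1n.
Qed.

Lemma cabs_quotient_ge z a : D z -> a \in s ->
  2 * cabs a / cabs (z - a) <= cabs (2 ^+ n * p.[0] / p.[z]).
Proof.
move=> Dz sa; rewrite cabs_quotientE (big_rem a sa) /= mulrCA.
rewrite ler_peMr//; first by rewrite (le_trans ler01)// ratio_ge1.
apply: mulr_ege1; first by rewrite exprn_ege1// ler1n.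
by apply: prod_ratio_ge1 => // b /mem_rem.
Qed.

(** The modulus of [expC w] depends only on the real part of [w], so for any branch the real part of
    [L] is the logarithm of the modulus of the quotient. *)
Lemma Re_L_ge z a : D z -> a \in s ->
  ln (2 * cabs a / cabs (z - a)) <= complex.Re (L z).
Proof.
move=> Dz sa; have q0 : 0 < 2 * cabs a / cabs (z - a).
  by rewrite divr_gt0 ?mulr_gt0 ?(root_cabs_gt0 sa)// cabs_gt0 subr_eq0 root_neq.
rewrite -ler_expR lnK ?posrE// -cabs_expC L_log.2//; exact: cabs_quotient_ge.
Qed.

(** Proved apart from the bound by a single root, because [s] may be empty. *)
Lemma Re_L_ge0 z : D z -> 0 <= complex.Re (L z).
Proof.
move=> Dz; rewrite -ler_expR expR0 -cabs_expC L_log.2//.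
exact: cabs_quotient_ge1.
Qed.

(** The product [expC (L w) * p.[w]] is constant on the disc; setting its derivative to zero and
    cancelling the nonzero factors gives [L' = - p' / p]. *)
Lemma derive1_L z : D z -> Cderiv L z = - \sum_(a <- s) (z - a)^-1.
Proof.
move=> Dz.
have dL := derivable_slope_at (L_log.1 z Dz).
have dE := slope_at_comp dL (slope_at_expC (L z)).
have dp := slope_at_horner p z.
have D0 : @slope_at _ (fun w => expC (L w) * p.[w]) z 0.
  apply: slope_at_near (slope_at_cst (2 ^+ n * p.[0]) z).
  (* The disc of radius [1 - cabs z] about [z] stays inside the unit disc. *)
  have e0 : 0 < 1 - cabs z by rewrite subr_gt0.
  apply: (near_cabsP e0) => w zw.
  have Dw : D w.
    have : cabs w <= cabs z + cabs (z - w).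
      by rewrite -(cabsN (z - w)) opprB -{1}(subrK z w) addrC ler_cabsD.
    by rewrite /unit_disc /=; lra.
  by rewrite L_log.2// divfK// p_neq0.
have := slope_at_unique (slope_atM dE dp) D0.
rewrite -/(Cderiv L z) /=.
have -> : p^`().[z] = p.[z] * \sum_(a <- s) (z - a)^-1.
  rewrite ps derivZ !hornerZ deriv_prod_XsubC ?mulrA//.
  by apply/negP => /root_neq-/(_ _ Dz); rewrite eqxx.
move=> /eqP H; apply/eqP.
rewrite -addr_eq0; move: H.
rewrite (_ : _ + _ = expC (L z) * p.[z] *
  (Cderiv L z + \sum_(a <- s) (z - a)^-1)); last by ring.
by rewrite !mulf_eq0 (negbTE (expC_neq0 _)) (negbTE (p_neq0 Dz)).
Qed.

(** The real part of [1 + L z] is at least [1], so the chain rule meets [Log] only in the right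
    half-plane. *)
Lemma derive1_F z : D z ->
  Cderiv (fun w => Log (1 + L w)) z = Cderiv L z / (1 + L z).
Proof.
move=> Dz; have L0 := Re_L_ge0 Dz.
have dL := derivable_slope_at (L_log.1 z Dz).
have d1 := slope_atD (slope_at_cst 1 z) dL.
have Re1 : 0 < complex.Re (1 + L z) by rewrite raddfD /=; lra.
have := slope_at_comp d1 (slope_at_Log Re1).
by move/slope_at_derive1 => dF; apply: etrans dF _; rewrite add0r mulrC.
Qed.

(** The common denominator [1 + L z] is bounded below separately in each summand, by the logarithm
    attached to the root of that summand. *)
Lemma cabs_derive1_F_le z : D z ->
  cabs (Cderiv (fun w => Log (1 + L w)) z) <=
  \sum_(a <- s) (cabs (z - a) * (1 + ln (2 * cabs a / cabs (z - a))))^-1.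
Proof.
move=> Dz; rewrite derive1_F// derive1_L// mulNr cabsN mulr_suml.
rewrite big_seq [X in _ <= X]big_seq.
elim/big_ind2 : _ => [|u x v y ux vy|a sa]; first by rewrite Normc.normc0.
  exact: le_trans (ler_cabsD _ _) (lerD ux vy).
have t0 : 0 <= ln (2 * cabs a / cabs (z - a)).
  exact: ln_ge0 (ratio_ge1 Dz sa).
have u0 : 0 < cabs (z - a) by rewrite cabs_gt0 subr_eq0 root_neq.
have := Re_L_ge Dz sa.
have : complex.Re (1 + L z) <= cabs (1 + L z).
  exact: le_trans (ler_norm _) (ler_Re_cabs _).
rewrite raddfD /= => h1 h2.
rewrite Normc.normcM !Normc.normcV -invfM lef_pV2 ?posrE ?mulr_gt0//; last 2 first.
- lra.
- lra.
by rewrite ler_pM2l//; lra.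
Qed.

Lemma area_integral_le :
  (area_integral D
     (fun z => (cabs (Cderiv (fun w => Log (1 + L w)) z) ^+ 2 / pi)%:E)
     <= (16 * n%:R ^+ 2)%:E)%E.
Proof.
have pi0 := pi_gt0 R; pose m := size s.
have mpi0 : 0 <= m%:R / pi :> R by rewrite divr_ge0 ?ler0n ?pi_ge0.
(* The factor [m] comes from Cauchy-Schwarz over the [m] roots, and [pi] from the normalised
   area. *)
pose G (v : R * R) : \bar R := ((m%:R / pi)%:E * \sum_(a <- s) majorant a v)%E.
have majorant0 a v : (0 <= majorant a v)%E.
  by apply: nneseries_ge0 => k _ _; exact: majorant_term_ge0.
have G0 v : (0 <= G v)%E.
  by apply: mule_ge0; [rewrite lee_fin|exact: sume_ge0].
rewrite /area_integral.
(* The majorant is nonnegative, so the domain may grow to the whole plane, where each square has its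
   full area. *)
apply: (@le_trans _ _ (\int[mu2]_v G v)%E).
  apply: ge0_le_integral_superset => //.
    by move=> v _; rewrite lee_fin divr_ge0 ?sqr_ge0 ?pi_ge0.
  move=> [x y] /= Dz; set z := x +i* y in Dz *.
  pose x_ a := (cabs (z - a) * (1 + ln (2 * cabs a / cabs (z - a))))^-1.
  have F2 : cabs (Cderiv (fun w => Log (1 + L w)) z) ^+ 2 <=
      m%:R * \sum_(a <- s) x_ a ^+ 2.
    apply: le_trans (sqr_sum_le _ _); have FS := cabs_derive1_F_le Dz.
    by rewrite ler_pXn2r ?nnegrE ?cabs_ge0// (le_trans _ FS) ?cabs_ge0.
  apply: le_trans (_ : ((m%:R / pi)%:E * (\sum_(a <- s) x_ a ^+ 2)%:E <= _)%E).
    by rewrite -EFinM lee_fin [X in _ <= X]mulrAC ler_pM2r ?invr_gt0.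
  rewrite /G lee_wpmul2l ?lee_fin// -sumEFin.
  rewrite big_seq [X in (_ <= X)%E]big_seq; apply: lee_sum => a sa.
  by rewrite /x_ exprVn majorant_ge ?cabs_root_le// root_neq.
rewrite /G ge0_integralZl_EFin//; last 2 first.
- by move=> v _; exact: sume_ge0.
- by apply: emeasurable_sum => a; exact: measurable_majorant.
rewrite ge0_integral_sum//; last by move=> a; exact: measurable_majorant.
have S32 : (\sum_(a <- s) \int[mu2]_v majorant a v <= (32 * m%:R)%:E)%E.
  apply: le_trans (_ : (\sum_(a <- s) 32%:E <= _)%E).
    rewrite big_seq [X in (_ <= X)%E]big_seq; apply: lee_sum => a sa.
    by apply: integral_majorant; rewrite -cabs_gt0 root_cabs_gt0.
  by rewrite sumEFin lee_fin big_const_seq count_predT iter_addr_0 mulr_natr.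
apply: le_trans (lee_wpmul2l _ S32) _; first by rewrite lee_fin.
rewrite -EFinM lee_fin mulrAC ler_pdivrMr//.
have mn : m%:R <= n%:R :> R by rewrite ler_nat.
have mm : m%:R ^+ 2 <= n%:R ^+ 2 :> R by rewrite ler_pXn2r ?nnegrE.
(* The constant [16] results from [32 * m ^+ 2 / pi] by [pi >= 2]. *)
have := ler_pM (sqr_ge0 _) _ mm (pi_ge2 R); have := sqr_ge0 (n%:R : R).
nra.
Qed.

End log_branch_energy.

(** * Reduction to a factored polynomial *)

Theorem lemma6p3 (R : realType) (n : nat) (p : {poly R[i]})
    (deg_p : (size p <= n.+1)%N)
    (p_nz : forall z : R[i], @unit_disc R z -> p.[z] <> 0)
    (L : R[i] -> R[i])
    (L_log : log_branch (@unit_disc R) (fun z => 2 ^+ n * p.[0] / p.[z]) L) :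
  let F := fun z : R[i] => Log (1 + L z) in
  (area_integral (@unit_disc R) (fun z => (cabs (Cderiv F z) ^+ 2 / pi)%:E)
     <= (16 * n%:R ^+ 2)%:E)%E.
Proof.
(* [R[i]] is algebraically closed, so [p] splits into linear factors. *)
cbv zeta; have [s ps] := closed_field_poly_normal p.
have p0 : p != 0.
  apply/eqP => p0; apply: (p_nz 0); last by rewrite p0 horner0.
  by suff: cabs (0 : R[i]) < 1 by []; rewrite Normc.normc0 ltr01.
have c0 : lead_coef p != 0 by rewrite lead_coef_eq0.
apply: (area_integral_le ps _ c0 _ L_log).
(* The size of a nonzero polynomial is its degree plus one, so [n.+1] bounds the number of roots by
   [n]. *)
- by move: deg_p; rewrite ps size_scale// size_prod_XsubC ltnS.
- move=> a sa; rewrite leNgt; apply/negP => a1; apply: (p_nz a a1).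
  by apply/rootP; rewrite ps rootZ// root_prod_XsubC.
Qed.
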